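(* Let $f:\mathbb{N}\to\mathbb{R}$ be any function with $f(N)\to\infty$ as $N\to\infty$. Then there is a set $S\subseteq\mathbb{N}$ (depending on $f$) of natural density zero such that for every positive integer $N\notin S$ (with $N\ge 16$, so that $\log\log N>0$) \[ \gcd(N,\sigma(N))\le (\log\log N)^{f(N)}. \]
   Context: $\sigma(N)$ denotes the sum of the positive divisors of $N$. A set $S\subseteq\mathbb{N}$ has natural density zero if $\#\{n\le x: n\in S\}/x\to 0$ as $x\to\infty$. *)

(* Defs.v *)
From HB Require Import structures.
From mathcomp Require Import all_boot all_order all_algebra finmap.
From mathcomp Require Import all_classical all_reals all_analysis.
Set Implicit Arguments.
Unset Strict Implicit.
Unset Printing Implicit Defensive.
Import Order.TTheory GRing.Theory Num.Theory numFieldNormedType.Exports.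
Local Open Scope classical_set_scope.
Local Open Scope ring_scope.

Definition sigma (N : nat) : nat := (\sum_(d <- divisors N) d)%N.

(* The set inside [fset_set] is always finite, so the junk value of [fset_set]
   on infinite sets is never used. *)
Definition count_upto (R : realType) (S : set nat) (x : R) : nat :=
  #|` fset_set [set n : nat | S n /\ n%:R <= x]|%fset.

Definition natural_density_zero (R : realType) (S : set nat) : Prop :=
  (count_upto S x)%:R / x @[x --> (+oo : set_system R)] --> (0 : R).

(* Main.v *)
Require Import Defs.
From HB Require Import structures.
From mathcomp Require Import all_boot all_order all_algebra.
From mathcomp Require Import all_classical all_reals all_analysis.
From mathcomp Require Import finmap zify lra ring.
Import Order.TTheory GRing.Theory Num.Theory numFieldNormedType.Exports.
Set Implicit Arguments.
Unset Strict Implicit.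
Unset Printing Implicit Defensive.

(* Let L and D be about log n and log log n, and z = D^6. If a prime p > z
   divides N <= n and sigma(N), then p divides sigma(q^e) for some prime power
   q^e exactly dividing N. For e = 1, p q divides N for a prime q = -1 mod p;
   Chebyshev's binomial argument applied to the progression pk - 1 shows that the
   sum of 1/q over these q is O(D / sqrt p), so such N number O(n / D). For e > 1, N is
   divisible by the square of some d > D, which again happens for O(n / D) values
   of N. For the other N, gcd(N, sigma(N)) is composed of primes <= z, and the
   logarithm of the z-smooth part of N has mean O(log z) = O(log D), so by Markov's
   inequality the gcd exceeds D^(K/2) for at most O(n / K) of them. Since
   log log N >= sqrt D when N > n / D, letting K go to infinity gives density 0. *)

Local Open Scope nat_scope.

(** * Multiplicativity of [sigma] and its prime divisors *)

Lemma sigmaM m n : coprime m n -> sigma (m * n) = sigma m * sigma n.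
Proof.
case: (posnP m) => [->|m0]; first by rewrite /coprime gcd0n => /eqP ->; rewrite /sigma !big_seq1.
case: (posnP n) => [->|n0 co]; first by rewrite /coprime gcdn0 => /eqP ->; rewrite /sigma !big_seq1.
rewrite /sigma.
(* Both factors of a divisor [a * b] of [m * n] are recovered by gcds with [m] and [n], so the
   splitting of divisors is a bijection. *)
have gl a b : a %| m -> b %| n -> gcdn m (a * b) = a.
  move=> am bn; rewrite Gauss_gcdl ?(coprime_dvdr bn) //.
  by apply/gcdn_idPr.
have gr a b : a %| m -> b %| n -> gcdn n (a * b) = b.
  move=> am bn; rewrite Gauss_gcdr ?(coprime_dvdr am) 1?coprime_sym //.
  by apply/gcdn_idPr.
have H : perm_eq (divisors (m * n)) [seq a * b | a <- divisors m, b <- divisors n].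
  apply: uniq_perm; first exact: divisors_uniq.
    apply: allpairs_uniq; rewrite ?divisors_uniq // => -[a b] [c d] /=.
    move=> /allpairsP[[a' b'] /= [+ + [-> ->]]] /allpairsP[[c' d'] /= [+ + [-> ->]]].
    rewrite -!dvdn_divisors // => am bn cm dn E.
    by congr pair; [rewrite -(gl _ _ am bn) E gl|rewrite -(gr _ _ am bn) E gr].
  move=> d; rewrite -dvdn_divisors ?muln_gt0 ?m0 //.
  apply/idP/allpairsP => [dmn|[[a b] /= []]]; last first.
    by rewrite -!dvdn_divisors // => am bn ->; rewrite dvdn_mul.
  have ad := dvdn_gcdr m d.
  exists (gcdn m d, d %/ gcdn m d) => /=.
  rewrite -!dvdn_divisors // dvdn_gcdl; split => //; last by rewrite mulnC divnK.
  have g0 : 0 < gcdn m d by rewrite gcdn_gt0 m0.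
  rewrite -(@Gauss_dvdr _ (m %/ gcdn m d)).
    by rewrite -(dvdn_pmul2l g0) mulnA ![gcdn m d * (_ %/ _)]mulnC !divnK ?dvdn_gcdl.
  by rewrite /coprime -(eqn_pmul2l g0) muln_gcdr ![gcdn m d * (_ %/ _)]mulnC
             !divnK ?dvdn_gcdl // gcdnC muln1.
by rewrite (perm_big _ H) big_allpairs_dep /= big_distrlr.
Qed.

Lemma leq_sigma_sqr n : 0 < n -> sigma n <= n ^ 2.
Proof.
move=> n0.
have dn d : d \in divisors n -> 0 < d <= n.
  by rewrite -dvdn_divisors // => dn; rewrite (dvdn_gt0 n0 dn) dvdn_leq.
rewrite /sigma big_seq.
apply: (@leq_trans (\sum_(d <- divisors n | d \in divisors n) n)).
  by apply: leq_sum => d /dn/andP[].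
rewrite -big_seq big_const_seq count_predT iter_addn_0 -mulnn leq_mul2l; apply/orP; right.
rewrite -[leqRHS](size_iota 1); apply: uniq_leq_size; first exact: divisors_uniq.
by move=> d /dn; rewrite mem_iota; lia.
Qed.

Lemma sigma_prime q : prime q -> sigma q = q.+1.
Proof.
move=> pq; rewrite /sigma.
have H : perm_eq (divisors q) [:: 1; q].
  apply: uniq_perm; first exact: divisors_uniq.
    by rewrite /= andbT inE neq_ltn prime_gt1.
  move=> d; rewrite -dvdn_divisors ?prime_gt0 // !inE.
  by apply/idP/orP => [/(primeP pq).2/orP[]|[/eqP->|/eqP->]] ; rewrite ?dvd1n ?dvdnn; [left|right|..].
by rewrite (perm_big _ H) !big_cons big_nil /= addn0 add1n.
Qed.

(** Strong induction: the full power of the smallest prime of [N] is split off, and Euclid's lemma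
    says which factor of the multiplicative [sigma] is divisible by [p]. *)
Lemma prime_dvd_sigma p N : prime p -> 0 < N -> p %| sigma N ->
  exists2 q, q \in primes N & p %| sigma (q ^ logn q N).
Proof.
move=> pp; elim/ltn_ind: N => N IH N0 pN.
case: (ltngtP 1 N) => [N1|N1|N1]; last first.
- move: pN; rewrite -N1 (_ : sigma 1 = 1); last by rewrite /sigma big_seq1.
  by rewrite dvdn1 => /eqP p1; rewrite p1 in pp.
- by move: N1; case: (N) N0.
set q := pdiv N; have pq : prime q by exact: pdiv_prime.
have qN : q %| N := pdiv_dvd N.
have [M coM EN] := pfactor_coprime pq N0.
have e0 : 0 < logn q N by rewrite logn_gt0 mem_primes pq N0.
move: (pN); rewrite {1}EN sigmaM; last by rewrite coprime_sym coprimeXl.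
rewrite Euclid_dvdM // => /orP[pM|]; last first.
  by exists q => //; rewrite mem_primes pq N0.
have M0 : 0 < M by move: N0; rewrite EN muln_gt0 => /andP[].
have MN : M < N.
  by rewrite EN -[ltnLHS]muln1 ltn_pmul2l // -(exp1n (logn q N)) ltn_exp2r ?prime_gt1.
have [r rM pr] := IH M MN M0 pM.
move: rM; rewrite mem_primes M0 /= => /andP[prr rM].
exists r; first by rewrite mem_primes prr N0 EN dvdn_mulr.
suff -> : logn r N = logn r M by [].
rewrite EN lognM //.
rewrite lognX (logn_prime _ pq).
suff /negbTE -> : r != q by rewrite muln0 addn0.
by apply: contraTneq rM => ->; rewrite -prime_coprime.
Qed.

Lemma prime_dvd_sigma_cases p N D : prime p -> 3 < p -> D ^ 6 < p ->
  0 < N -> p %| N -> p %| sigma N ->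
  (exists k, [/\ 1 < k, prime (p * k - 1) & p * (p * k - 1) %| N]) \/
  (exists2 d, D < d & d ^ 2 %| N).
Proof.
move=> pp p3 Dp N0 pN pS.
have [q] := prime_dvd_sigma pp N0 pS.
rewrite mem_primes N0 /= => /andP[pq qN].
have e0 : 0 < logn q N by rewrite logn_gt0 mem_primes pq N0.
have qe : q ^ logn q N %| N by exact: pfactor_dvdnn.
have [->|e1] : logn q N = 1 \/ 1 < logn q N by lia.
  rewrite expn1 sigma_prime // => /dvdnP[k Ek]; left; exists k.
  have Eq : p * k - 1 = q by rewrite mulnC -Ek subn1.
  rewrite Eq; split => //.
    (* [k = 1] would make [q = p - 1] an even prime, so [p = 3], against [3 < p]. *)
    case: k Ek {Eq} => [|[|k]] //; rewrite mul1n => Ek.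
    have : odd p by case: (even_prime pp) => // p2; rewrite p2 in p3.
    rewrite -Ek /=; case: (even_prime pq) => [q2|->] //; lia.
  rewrite Gauss_dvd ?pN // prime_coprime //; rewrite dvdn_prime2 //; apply/negP => /eqP E.
  have : p %| q.+1 by rewrite Ek dvdn_mull.
  by rewrite E -addn1 dvdn_addr // dvdn1 => /eqP q1; rewrite q1 in pq.
(* With [e = logn q N], the witness is [d = q ^ e./2]. As [e <= 3 * e./2] for [e >= 2], [p <= sigma
   (q ^ e) <= q ^ (2 * e) <= d ^ 6]; hence the sixth power in [D ^ 6 < p]. *)
move=> pS1; right; exists (q ^ (logn q N)./2); last first.
  by apply: dvdn_trans qe; rewrite -expnM dvdn_exp2l //; lia.
rewrite ltnNge; apply/negP => dD.
have : p <= sigma (q ^ logn q N).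
  apply: dvdn_leq pS1; rewrite /sigma lt0n sum_nat_seq_neq0.
  apply/hasP; exists 1; rewrite //= -dvdn_divisors ?expn_gt0 ?prime_gt0 //.
move=> /(leq_trans Dp); rewrite ltnNge => /negP; apply.
apply: (leq_trans (leq_sigma_sqr _)); first by rewrite expn_gt0 prime_gt0.
rewrite -expnM.
have : (q ^ (logn q N)./2) ^ 6 <= D ^ 6 by rewrite leq_exp2r.
by apply: leq_trans; rewrite -expnM leq_pexp2l ?prime_gt0 //; lia.
Qed.

(** * Factorials and Chebyshev's argument in the progression pk - 1 *)

Lemma logn_fact_bound p m : prime p -> logn p m`! * p.-1 <= m.
Proof.
move=> pp; rewrite logn_fact // big_add1 /=.
(* Partial sums of Legendre's formula; the extra term [m %/ p ^ K] absorbs the next summand, since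
   [p * (m %/ p ^ K.+1) <= m %/ p ^ K]. *)
suff H K : (\sum_(0 <= k < K) m %/ p ^ k.+1) * p.-1 + m %/ p ^ K <= m.
  by apply: leq_trans (H m); rewrite leq_addr.
elim: K => [|K IH]; first by rewrite big_geq // mul0n expn0 divn1.
rewrite big_nat_recr //= mulnDl; apply: leq_trans IH.
rewrite -addnA leq_add2l -mulnSr prednK ?prime_gt0 //.
by rewrite expnSr divnMA leq_trunc_div.
Qed.

(** For a run starting at [b.+1] the quotient is the binomial coefficient ['C(b + m, m)]. *)
Lemma fact_dvd_prod_consecutive b m : m`! %| \prod_(i < m) (b + i).
Proof.
case: b => [|b].
  case: m => [|m]; first by rewrite big_ord0.
  by rewrite big_ord_recl mul0n dvdn0.
have E : b`! * \prod_(i < m) (b.+1 + i) = (b + m)`!.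
  elim: m => [|m IH]; first by rewrite big_ord0 muln1 addn0.
  by rewrite big_ord_recr /= mulnA IH addnS factS addSn mulnC.
rewrite -(@dvdn_pmul2l b`!) ?fact_gt0 // E.
apply/dvdnP; exists 'C(b + m, m).
have := @bin_fact (b + m) m (leq_addl _ _); rewrite addnK => <-; lia.
Qed.

Lemma coprime_prodr_seq (I : Type) (r : seq I) (P : pred I) (F : I -> nat) n :
  (forall i, P i -> coprime n (F i)) -> coprime n (\prod_(i <- r | P i) F i).
Proof.
move=> H; elim/big_rec: _ => [|i x Pi cx]; first by rewrite coprimen1.
by rewrite coprimeMr H.
Qed.

(* Multiplying by the m-th power of an inverse of d modulo A turns the
   progression into m consecutive integers. *)
Lemma dvd_prod_progression A d a m : 0 < A -> coprime d A -> A %| m`! ->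
  A %| \prod_(i < m) (a + d * i).
Proof.
move=> A0 co Am.
have [A1|A1] := leqP A 1; first by have -> : A = 1 by lia.
have d0 : 0 < d by case: d co => // ; rewrite /coprime gcd0n => /eqP E; rewrite E in A1.
have [[u v] /= uv] := coprimeP A d0 co.
have Du : d * u = v * A + 1 by nia.
have cu : coprime A u.
  rewrite coprime_sym; apply: modn_coprime; first by case: u uv {Du}.
  by exists d; rewrite mulnC Du modnMDl modn_small.
rewrite -(@Gauss_dvdr _ (u ^ m)) ?coprimeXr //.
have -> : u ^ m * \prod_(i < m) (a + d * i) = \prod_(i < m) (u * (a + d * i)).
  by rewrite big_split /= prod_nat_const card_ord.
have E : \prod_(i < m) (u * (a + d * i)) = \prod_(i < m) (u * a + i) %[mod A].
  apply: (big_ind2 (fun x y => x = y %[mod A])) => //.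
    by move=> x1 x2 y1 y2 H1 H2; rewrite -modnMml H1 modnMml -modnMmr H2 modnMmr.
  move=> i _; rewrite mulnDr (_ : u * (d * i) = (v * i) * A + i); first by rewrite addnCA modnMDl.
  by rewrite mulnA [u * d]mulnC Du mulnDl mul1n mulnAC.
rewrite /dvdn E; apply: dvdn_trans Am _; exact: fact_dvd_prod_consecutive.
Qed.

(** The falling factorial of [m + m] lies between the two sides: each of its [m] factors is at least
    [m], and it is [m!] times a central binomial coefficient, one term of [(1 + 1) ^ (m + m)]. *)
Lemma leq_exp_fact m : m ^ m <= 4 ^ m * m`!.
Proof.
have H : m ^ m <= (m + m) ^_ m.
  rewrite ffact_prod -[X in _ ^ X]card_ord -prod_nat_const.
  by apply: leq_prod => i _; have := ltn_ord i; lia.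
apply: leq_trans H _; rewrite -bin_ffact leq_mul2r; apply/orP; right.
rewrite -[4]/(2 ^ 2) -expnM mul2n -addnn -[2]/(1 + 1) expnDn.
have lt : m < (m + m).+1 by lia.
rewrite (bigD1 (Ordinal lt)) //= !exp1n !muln1; exact: leq_addr.
Qed.

(* Chebyshev's argument: the part of m! prime to p divides the product of the
   m terms, and it is prime to the terms that are primes. *)
Lemma prod_primes_progression p m : prime p -> 0 < m ->
  \prod_(m.+1 <= k < m.*2.+1 | prime (p * k - 1)) (p * k - 1) <= (8 * p ^ 2) ^ m.
Proof.
move=> pp m0; have p1 := prime_gt1 pp.
set Q := \prod_(_ <= _ < _ | _) _.
pose A := (m`!)`_p^'.
have A0 : 0 < A by exact: part_gt0.
have cA : coprime p A.
  by rewrite prime_coprime // -p'natE // part_pnat.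
set P := \prod_(m.+1 <= k < m.*2.+1) (p * k - 1).
have EP : P = \prod_(i < m) ((p * m.+1 - 1) + p * i).
  rewrite /P -{1}[m.+1]add0n big_addn (_ : m.*2.+1 - m.+1 = m); last lia.
  by rewrite big_mkord; apply: eq_bigr => i _; nia.
have AP : A %| P by rewrite EP dvd_prod_progression // dvdn_part.
have QP : Q %| P.
  by rewrite /P (bigID (fun k => prime (p * k - 1))) /= dvdn_mulr.
have cAQ : coprime A Q.
  rewrite /Q big_nat_cond; apply: coprime_prodr_seq => k /andP[/andP[mk _] pk].
  rewrite coprime_sym prime_coprime //; apply/negP => /(fun H => dvdn_trans H (dvdn_part _ _)).
  (* A prime exceeding [m] divides no factor of [m!]. *)
  have : m < p * k - 1 by nia.
  elim: (m) => [|j IH] jk; first by rewrite dvdn1 => /eqP E; rewrite E in pk.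
  rewrite factS Euclid_dvdM // => /orP[/dvdn_leq|]; [by lia|apply: IH; lia].
have AQ : A * Q <= P.
  apply: dvdn_leq; last by rewrite Gauss_dvd ?AP.
  by rewrite EP prodn_gt0 // => i; nia.
have PB : P <= (2 * p * m) ^ m.
  rewrite EP -[X in _ ^ X]card_ord -prod_nat_const.
  by apply: leq_prod => i _; have := ltn_ord i; nia.
have BB : (m`!)`_p <= p ^ m.
  rewrite p_part leq_exp2l //.
  by apply: leq_trans (logn_fact_bound m pp); rewrite leq_pmulr //; lia.
have FM : m`! = (m`!)`_p * A by rewrite partnC // fact_gt0.
(* The factor 4 comes from [leq_exp_fact], one [p] from the p-part of [m!], and [2 * p * m] from the
   size of each term of [P]. *)
have : Q * m ^ m <= (8 * p ^ 2) ^ m * m ^ m.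
  apply: (@leq_trans (4 ^ m * (p ^ m * (2 * p * m) ^ m))).
    apply: leq_trans (leq_mul (leqnn Q) (leq_exp_fact m)) _.
    rewrite FM mulnCA leq_mul2l; apply/orP; right.
    by rewrite mulnCA leq_mul // mulnC; apply: leq_trans AQ PB.
  by rewrite -!expnMn; apply/eq_leq; congr (_ ^ _); nia.
by rewrite leq_pmul2r // expn_gt0 m0.
Qed.

Local Open Scope classical_set_scope.
Local Open Scope ring_scope.

(** * Logarithm estimates and sums of reciprocals *)

Lemma le_ln_nat (R : realType) (m n : nat) : (0 < m)%N -> (m <= n)%N ->
  ln (m%:R : R) <= ln n%:R.
Proof. by move=> m0 mn; rewrite ler_ln ?posrE ?ltr0n ?ler_nat //; apply: leq_trans mn. Qed.

Lemma ln2_bounds (R : realType) : 1 / 2 <= ln (2 : R) <= 1.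
Proof.
apply/andP; split; last by have := @le_ln1Dx R 1; rewrite -natr1; apply; lra.
have := @le_ln1Dx R (- 2^-1); have -> : 1 + - 2^-1 = 2^-1 :> R by lra.
by rewrite lnV ?posrE ?ltr0n // => /(_ _); lra.
Qed.

(** All primes counted are at least [p * m]. The bound on their product therefore limits their
    number to [m * ln (8 * p ^ 2) / ln (p * m)], and each reciprocal is at most [1 / (p * m)]. *)
Lemma sum_inv_dyadic (R : realType) p m : prime p -> (0 < m)%N ->
  \sum_(m.+1 <= k < m.*2.+1 | prime (p * k - 1)) ((p * k - 1)%:R : R)^-1
  <= ln (8 * p ^ 2)%:R / (p%:R * ln (p * m)%:R).
Proof.
move=> pp m0; have p1 := prime_gt1 pp.
have pm0 : (0 < p * m)%N by rewrite muln_gt0; lia.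
set c := (\sum_(m.+1 <= k < m.*2.+1 | prime (p * k - 1)) 1)%N.
have pm1 : 0 < ln ((p * m)%:R : R) by rewrite ln_gt0 // ltr1n; nia.
have cle : c%:R * ln ((p * m)%:R : R) <= m%:R * ln (8 * p ^ 2)%:R.
  rewrite !mulr_natl -!lnXn ?ltr0n ?muln_gt0 ?expn_gt0 ?(ltnW p1) ?m0 //.
  rewrite -!natrX; apply: le_ln_nat; first by rewrite expn_gt0 pm0.
  apply: leq_trans (prod_primes_progression pp m0).
  rewrite expn_sum big_nat_cond [leqRHS]big_nat_cond; apply: leq_prod => k.
  by rewrite expn1; nia.
apply: (@le_trans _ _ (c%:R / (p * m)%:R)).
  rewrite /c natr_sum mulr_suml big_nat_cond [leRHS]big_nat_cond; apply: ler_sum => k H.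
  rewrite mul1r lef_pV2 ?posrE ?ltr0n // ?ler_nat; nia.
rewrite natrM in cle pm1 *.
have pR : 0 < (p%:R : R) by rewrite ltr0n; lia.
have mR : 0 < (m%:R : R) by rewrite ltr0n.
have -> : ln (8 * p ^ 2)%:R / (p%:R * ln (p%:R * m%:R)) =
  m%:R * ln (8 * p ^ 2)%:R / ln (p%:R * m%:R) / (p%:R * m%:R) :> R.
  by field; rewrite !gt_eqF.
by rewrite ler_pM2r ?invr_gt0 ?mulr_gt0 // ler_pdivlMr.
Qed.

Lemma ln_bound_sqrt (R : realType) p : (0 < p)%N ->
  ln ((8 * p ^ 2)%:R : R) <= 4 * Num.sqrt p%:R.
Proof.
move=> p0; have pR : 0 < (p%:R : R) by rewrite ltr0n.
have s0 : 0 < Num.sqrt (p%:R : R) by rewrite sqrtr_gt0.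
(* With [s = sqrt p], [ln 2 <= 1] and [ln s <= s - 1], the logarithm is at most
   [3 + 4 * (s - 1)]. *)
have -> : (8 * p ^ 2)%:R = 2 ^+ 3 * Num.sqrt (p%:R : R) ^+ 4.
  by rewrite natrM natrX (exprM _ 2 2) sqr_sqrtr ?ltW //; congr (_ * _); rewrite -natrX.
rewrite lnM ?posrE ?exprn_gt0 // !lnXn //.
have := @le_ln1Dx R (Num.sqrt p%:R - 1); rewrite [1 + _]addrC subrK => H.
have {}H : ln (Num.sqrt p%:R : R) <= Num.sqrt p%:R - 1 by apply: H; lra.
have /andP[_] := ln2_bounds R; lra.
Qed.

(** Dyadic blocks [2 ^ i < k <= 2 ^ i.+1]: since [ln (p * 2 ^ i) >= i.+1 / 2], block [i] contributes
    at most [8 / (sqrt p * i.+1)], which leaves a harmonic sum of length [L]. *)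
Lemma sum_inv_primes_progression (R : realType) p L : prime p ->
  \sum_(2 <= k < (2 ^ L).+1 | prime (p * k - 1)) ((p * k - 1)%:R : R)^-1
  <= 8 / Num.sqrt p%:R * \sum_(0 <= i < L) (i.+1%:R)^-1.
Proof.
move=> pp; have p1 := prime_gt1 pp.
elim: L => [|L IH]; first by rewrite !big_geq ?mulr0.
rewrite (@big_cat_nat _ _ _ (2 ^ L).+1) /=; [|by have := expn_gt0 2 L; lia|by rewrite ltnS leq_exp2l].
rewrite [in leRHS]big_nat_recr //= mulrDr lerD //.
have pL : (0 < 2 ^ L)%N by rewrite expn_gt0.
rewrite expnS mul2n; apply: le_trans (sum_inv_dyadic R pp pL) _.
have pR : 0 < (p%:R : R) by rewrite ltr0n; lia.
set s := Num.sqrt p%:R.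
have s0 : 0 < s by rewrite sqrtr_gt0.
have Ep : p%:R = s ^+ 2 by rewrite sqr_sqrtr ?ltW.
have lnl : (L.+1)%:R / 2 <= ln ((p * 2 ^ L)%:R : R).
  apply: (@le_trans _ _ (ln ((2 ^ L.+1)%:R))).
    rewrite natrX lnXn // -[leRHS]mulr_natl; have /andP[H _] := ln2_bounds R.
    by rewrite ler_pM2l ?ltr0n // -div1r.
  by apply: le_ln_nat; rewrite ?expn_gt0 // expnS leq_mul2r p1 orbT.
have L0 : 0 < (L.+1%:R : R) by rewrite ltr0n.
apply: (@le_trans _ _ (4 * s / (s ^+ 2 * (L.+1%:R / 2)))).
  rewrite -Ep; apply: ler_pM; rewrite ?ln_ge0 ?invr_ge0 ?mulr_ge0 //; try lra.
  - by rewrite ler1n; nia.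
  - by apply: ln_bound_sqrt; lia.
  - by rewrite lef_pV2 ?posrE ?mulr_gt0 ?ler_pM2l //; lra.
by rewrite le_eqVlt; apply/orP; left; apply/eqP; field; rewrite !gt_eqF.
Qed.

(** The denominators from [2 ^ j] to [2 ^ j.+1 - 1] contribute at most 1 together. *)
Lemma harmonic_bound (R : realType) L D : (L < 2 ^ D)%N ->
  \sum_(0 <= i < L) (i.+1%:R : R)^-1 <= D%:R.
Proof.
move=> LD; apply: (@le_trans _ _ (\sum_(0 <= i < (2 ^ D).-1) (i.+1%:R)^-1)).
  rewrite [leRHS](@big_cat_nat _ _ _ L) //=; last by lia.
  by rewrite lerDl sumr_ge0 // => i _; rewrite invr_ge0 ler0n.
elim: D {L LD} => [|D IH]; first by rewrite big_geq.
have D0 : (0 < 2 ^ D)%N by rewrite expn_gt0.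
rewrite (@big_cat_nat _ _ _ (2 ^ D).-1) //=; last by rewrite expnS; lia.
rewrite -[leRHS]natr1 lerD //.
apply: (@le_trans _ _ (\sum_((2 ^ D).-1 <= i < (2 ^ D.+1).-1) ((2 ^ D)%:R)^-1)).
  rewrite big_nat [leRHS]big_nat; apply: ler_sum => i H; rewrite lef_pV2 ?posrE ?ltr0n ?ler_nat //; lia.
rewrite sumr_const_nat expnS (_ : _ - _ = 2 ^ D)%N; last lia.
by rewrite -[leLHS]mulr_natr mulVf // pnatr_eq0; lia.
Qed.

Lemma sum_inv_sqr_tail (R : realType) D M : (0 < D)%N ->
  \sum_(D.+1 <= d < M) ((d ^ 2)%:R : R)^-1 <= D%:R^-1.
Proof.
move=> D0; have [MD|DM] := leqP M D; first by rewrite big_geq ?invr_ge0 //; lia.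
(* Telescoping from [1 / (x + 1) ^ 2 <= 1 / x - 1 / (x + 1)]; the subtracted end term is what lets
   the induction close. *)
suff H j : \sum_(D.+1 <= d < D.+1 + j) ((d ^ 2)%:R : R)^-1 <= D%:R^-1 - (D + j)%:R^-1.
  have -> : M = (D.+1 + (M - D.+1))%N by lia.
  by apply: le_trans (H _) _; rewrite gerBl invr_ge0.
elim: j => [|j IH]; first by rewrite !addn0 big_geq // subrr.
rewrite addnS big_nat_recr ?leq_addr //=.
apply: (@le_trans _ _ (D%:R^-1 - (D + j)%:R^-1 + ((D + j)%:R^-1 - (D + j.+1)%:R^-1))); last by lra.
rewrite lerD // addSn addnS natrX -natr1.
have : 0 < ((D + j)%:R : R) by rewrite ltr0n; lia.
set x := _%:R => x0.
have -> : x^-1 - (x + 1)^-1 = (x * (x + 1))^-1.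
  by field; rewrite !gt_eqF //; lra.
by rewrite lef_pV2 ?posrE ?exprn_gt0 ?mulr_gt0 //; nra.
Qed.

Lemma sum_inv_sqrt3_tail (R : realType) z M : (0 < z)%N ->
  \sum_(z.+1 <= p < M) ((p%:R * Num.sqrt p%:R) : R)^-1 <= 2 / Num.sqrt z%:R.
Proof.
move=> z0; have [MD|DM] := leqP M z.
  by rewrite big_geq ?divr_ge0 ?sqrtr_ge0 //; lia.
suff H j : \sum_(z.+1 <= p < z.+1 + j) ((p%:R * Num.sqrt p%:R) : R)^-1 <=
    2 / Num.sqrt z%:R - 2 / Num.sqrt (z + j)%:R.
  have -> : M = (z.+1 + (M - z.+1))%N by lia.
  by apply: le_trans (H _) _; rewrite gerBl divr_ge0 ?sqrtr_ge0.
elim: j => [|j IH]; first by rewrite !addn0 big_geq // subrr.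
rewrite addnS big_nat_recr ?leq_addr //=.
apply: (@le_trans _ _ (2 / Num.sqrt z%:R - 2 / Num.sqrt (z + j)%:R +
   (2 / Num.sqrt (z + j)%:R - 2 / Num.sqrt (z + j.+1)%:R))); last by lra.
rewrite lerD // addSn addnS.
set a := Num.sqrt (z + j)%:R; set b := Num.sqrt _.
have a0 : 0 < a by rewrite sqrtr_gt0 ltr0n; lia.
have b0 : 0 < b by rewrite sqrtr_gt0 ltr0n.
have Ea : a ^+ 2 = (z + j)%:R by rewrite sqr_sqrtr.
have Eb : b ^+ 2 = (z + j).+1%:R by rewrite sqr_sqrtr.
have Eab : b ^+ 2 = a ^+ 2 + 1 by rewrite Eb Ea natr1.
rewrite -Eb.
have ab : a <= b by nra.
(* As [b ^ 2 - a ^ 2 = 1], this difference is [2 / (a * b * (a + b))], at least [1 / b ^ 3] because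
   [a <= b]; so the sum telescopes. *)
have -> : 2 / a - 2 / b = 2 * (b ^+ 2 - a ^+ 2) / (a * b * (a + b)).
  by field; rewrite !gt_eqF //; lra.
have -> : 2 * (b ^+ 2 - a ^+ 2) = 2 by rewrite Eab; ring.
rewrite ler_pdivlMr ?mulr_gt0 ?addr_gt0 //.
rewrite mulrC ler_pdivrMr ?mulr_gt0 ?exprn_gt0 //.
have : a * (a + b) <= 2 * b ^+ 2 by nra.
nra.
Qed.

(** * Mean logarithm of the smooth part *)

Lemma ln_nat_sum_primes (R : realType) n m : (0 < n)%N ->
  (forall p, prime p -> p %| n -> (p <= m)%N)%N ->
  ln (n%:R : R) = \sum_(0 <= p < m.+1 | prime p) (logn p n)%:R * ln p%:R.
Proof.
move=> n0 nm.
have E : n = (\prod_(0 <= p < m.+1 | prime p) p ^ logn p n)%N.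
  (* The factorization is taken over a range containing both bounds, then cut at [m], beyond which
     all exponents vanish. *)
  set x := maxn n m.
  have : n = (\prod_(0 <= p < x.+1) p ^ logn p n)%N.
    by rewrite -[LHS](partnT n0) (@widen_partn x) // leq_maxl.
  rewrite (@big_cat_nat _ _ _ m.+1) //= ?ltnS ?leq_maxr //.
  rewrite [X in (_ * X)%N]big_nat [X in (_ * X)%N]big1 => [|p /andP[mp _]]; last first.
    have [pp|np] := boolP (prime p); last by rewrite lognE (negbTE np).
    rewrite lognE pp n0 /=; case: ifP => // /(nm p pp); lia.
  rewrite muln1 => {1}->; rewrite [RHS]big_mkcond /=; apply: eq_bigr => p _.
  by have [//|np] := boolP (prime p); rewrite lognE (negbTE np).
rewrite {1}E.
elim: (index_iota 0 m.+1) => [|p r IH]; first by rewrite !big_nil ln1.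
rewrite !big_cons; have [pp|//] := boolP (prime p).
have pe : (0 < p ^ logn p n)%N by rewrite expn_gt0 prime_gt0.
have r0 : (0 < \prod_(j <- r | prime j) j ^ logn j n)%N.
  by rewrite prodn_cond_gt0 // => q pq; rewrite expn_gt0 prime_gt0.
rewrite natrM lnM ?posrE ?ltr0n //.
by rewrite IH natrX lnXn ?ltr0n ?prime_gt0 // mulr_natl.
Qed.

(* In z! each prime p <= z occurs at least floor(z/p) >= z/(2p) times. *)
Lemma sum_ln_primes_div (R : realType) z : (0 < z)%N ->
  \sum_(0 <= p < z.+1 | prime p) ln (p%:R : R) / p%:R <= 2 * ln z%:R.
Proof.
move=> z0; have zR : 0 < (z%:R : R) by rewrite ltr0n.
have zz : (z`! <= z ^ z)%N.
  elim: (z) => [|j IH]; first by [].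
  rewrite factS expnS leq_mul2l /=; apply: leq_trans IH _.
  by case: j => // j; rewrite leq_exp2r.
have H : \sum_(0 <= p < z.+1 | prime p) (logn p z`!)%:R * ln p%:R <= z%:R * ln (z%:R : R).
  rewrite -ln_nat_sum_primes ?fact_gt0 //.
    rewrite mulr_natl -lnXn // -natrX; apply: le_ln_nat => //; exact: fact_gt0.
  move=> p pp; elim: (z) => [|j IH]; first by rewrite dvdn1 => /eqP E; rewrite E in pp.
  by rewrite factS Euclid_dvdM // => /orP[/dvdn_leq|/IH]; lia.
rewrite -(ler_pM2l zR) mulrCA -[leRHS]/(2 * _).
apply: le_trans (ler_wpM2l _ H); last by [].
rewrite !mulr_sumr big_nat_cond [leRHS]big_nat_cond; apply: ler_sum => p /andP[/andP[_ pz] pp].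
have p0 := prime_gt0 pp; have pR : 0 < (p%:R : R) by rewrite ltr0n.
rewrite mulrA [leRHS]mulrA mulrAC; apply: ler_wpM2r; first by rewrite ln_ge0 // ler1n.
rewrite ler_pdivrMr // -!natrM ler_nat.
have : (z %/ p <= logn p z`!)%N.
  rewrite logn_fact // big_ltn ?ltnS // expn1; exact: leq_addr.
have := ltn_ceil z p0; have : (0 < z %/ p)%N by rewrite divn_gt0.
nia.
Qed.

Lemma sum_logn_nat p n : prime p ->
  (\sum_(1 <= N < n.+1) logn p N = logn p n`!)%N.
Proof.
move=> pp; elim: n => [|n IH]; first by rewrite big_geq // logn1.
by rewrite big_nat_recr //= IH factS lognM ?fact_gt0 // addnC.
Qed.

(** After exchanging the sums, the total exponent of [p] over all [N <= n] is its exponent in [n!],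
    at most [n / (p - 1) <= 2 * n / p]; the bound on the sum of [ln p / p] finishes. *)
Lemma sum_smooth_weight (R : realType) n z : (0 < z)%N ->
  \sum_(1 <= N < n.+1) \sum_(0 <= p < z.+1 | prime p) (logn p N)%:R * ln p%:R
  <= n%:R * (4 * ln (z%:R : R)).
Proof.
move=> z0; rewrite exchange_big /=.
have := sum_ln_primes_div R z0.
move=> /(ler_wpM2l (_ : 0 <= n%:R * 2)) => /(_ ltac:(by rewrite mulr_ge0)).
have -> : n%:R * 2 * (2 * ln z%:R) = n%:R * (4 * ln z%:R) :> R by ring.
apply: le_trans.
rewrite mulr_sumr; apply: ler_sum => p pp.
rewrite -mulr_suml -natr_sum sum_logn_nat //.
have p1 := prime_gt1 pp; have pR : 0 < (p%:R : R) by rewrite ltr0n; lia.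
rewrite mulrCA [leRHS]mulrC; apply: ler_wpM2r; first by rewrite ln_ge0 // ler1n; lia.
rewrite ler_pdivlMr // -!natrM ler_nat.
by have := logn_fact_bound n pp; nia.
Qed.

(** * Counting the integers with a large gcd *)

Lemma sum_dvdn_le (R : realType) n d : (0 < d)%N ->
  \sum_(1 <= N < n.+1) ((d %| N)%N%:R : R) <= n%:R * d%:R^-1.
Proof.
move=> d0; rewrite -natr_sum -divn_count_dvd ler_pdivlMr ?ltr0n // -natrM ler_nat.
exact: leq_trunc_div.
Qed.

(** The three nonnegative terms match the three causes of a large gcd: a large prime with a partner
    in the progression, a large square divisor, or a heavy smooth part. One of them is at least 1
    when the gcd exceeds [T]. *)
Lemma gcd_sigma_indicator (R : realType) n D L N (T : R) :
  (1 < D)%N -> (n <= 2 ^ L)%N -> 1 < T -> (0 < N <= n)%N ->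
  ((T < (gcdn N (sigma N))%:R)%R)%:R <=
  \sum_((D ^ 6).+1 <= p < n.+1 | prime p)
    \sum_(2 <= k < (2 ^ L).+1 | prime (p * k - 1)) ((p * (p * k - 1)) %| N)%N%:R
  + \sum_(D.+1 <= d < n.+1) (d ^ 2 %| N)%N%:R
  + (\sum_(0 <= p < (D ^ 6).+1 | prime p) (logn p N)%:R * ln p%:R) / ln T :> R.
Proof.
move=> D1 nL T1 /andP[N0 Nn].
have lT : 0 < ln T by rewrite ln_gt0.
set A := \sum_(_ <= p < n.+1 | _) _; set B := \sum_(_ <= d < _) _; set W := _ / ln T.
have A0 : 0 <= A by rewrite sumr_ge0 // => p _; rewrite sumr_ge0.
have B0 : 0 <= B by rewrite sumr_ge0.
have W0 : 0 <= W.
  apply: divr_ge0; last exact: ltW.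
  apply: sumr_ge0 => p pp.
  by rewrite mulr_ge0 // ln_ge0 // ler1n prime_gt0.
case: ltP => [Tg|]; last by move=> _; rewrite !addr_ge0.
change (1 <= A + B + W); set g := gcdn N (sigma N) in Tg.
have g0 : (0 < g)%N by rewrite gcdn_gt0 N0.
have [/existsP[p0 /and3P[pp gp Dp]]|no] :=
  boolP [exists p : 'I_n.+1, [&& prime p, (p %| g)%N & (D ^ 6 < p)%N]].
  have p3 : (3 < p0)%N by apply: leq_ltn_trans Dp; apply: (@leq_trans (2 ^ 6)); rewrite ?leq_exp2r.
  have [pN pS] : (p0 %| N)%N /\ (p0 %| sigma N)%N by move: gp; rewrite dvdn_gcd => /andP[].
  have [[k [k1 pk dv]]|[d Dd dv]] := prime_dvd_sigma_cases pp p3 Dp N0 pN pS.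
    suff : 1 <= A by lra.
    have kn : (p0 * k - 1 <= n)%N.
      by apply: leq_trans Nn; apply: dvdn_leq => //; apply: dvdn_trans dv; rewrite dvdn_mull.
    have kL : (k < (2 ^ L).+1)%N by rewrite ltnS; apply: leq_trans nL; apply: leq_trans kn; clear -p3 k1; nia.
    rewrite /A big_mkcond (bigD1_seq (p0 : nat)) ?mem_index_iota ?iota_uniq ?Dp ?ltn_ord //= pp.
    rewrite big_mkcond (bigD1_seq k) ?mem_index_iota ?iota_uniq ?k1 ?kL //= pk dv.
    rewrite -addrA lerDl addr_ge0 // sumr_ge0 // => i _; case: ifP => // _; exact: sumr_ge0.
  suff : 1 <= B by lra.
  have dn : (d < n.+1)%N.
    by rewrite ltnS; apply: leq_trans Nn; apply: dvdn_leq => //; apply: dvdn_trans dv; rewrite dvdn_exp.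
  rewrite /B (bigD1_seq d) ?mem_index_iota ?iota_uniq ?Dd ?dn //= dv.
  by rewrite lerDl sumr_ge0.
suff : 1 <= W by lra.
rewrite ler_pdivlMr // mul1r.
(* Markov's inequality in pointwise form: here [g] has no prime above [D ^ 6], and its exponents are
   at most those of [N]. *)
apply: (@le_trans _ _ (ln g%:R)); first by rewrite ler_ln ?posrE ?ltr0n ?ltW //; lra.
rewrite (@ln_nat_sum_primes _ _ (D ^ 6)) //; last first.
  move=> p pp pg; rewrite leqNgt; apply/negP => Dp; move/negP: no; apply.
  have pn : (p < n.+1)%N.
    by rewrite ltnS; apply: leq_trans Nn; apply: dvdn_leq => //; apply: dvdn_trans pg (dvdn_gcdl _ _).
  by apply/existsP; exists (Ordinal pn); rewrite pp pg Dp.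
apply: ler_sum => p pp; apply: ler_wpM2r; first by rewrite ln_ge0 // ler1n prime_gt0.
by rewrite ler_nat dvdn_leq_log // dvdn_gcdl.
Qed.

(** The progression gives [8 * D * 2 / sqrt (D ^ 6) = 16 / D ^ 2 <= 16 / D], the squares give
    [1 / D], and the smooth part gives [4 * ln (D ^ 6) = 24 * ln D] over [ln T]. *)
Lemma count_large_gcd_sigma (R : realType) n D L (T : R) :
  (1 < D)%N -> (L < 2 ^ D)%N -> (n <= 2 ^ L)%N -> 1 < T ->
  \sum_(1 <= N < n.+1) ((T < (gcdn N (sigma N))%:R)%R)%:R
  <= n%:R * (17 / D%:R + 24 * ln D%:R / ln T).
Proof.
move=> D1 LD nL T1.
have lT : 0 < ln T by rewrite ln_gt0.
have DR : 1 < (D%:R : R) by rewrite ltr1n.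
have nR : 0 <= (n%:R : R) by [].
have D6 : (0 < D ^ 6)%N by rewrite expn_gt0; lia.
rewrite big_nat; apply: le_trans (ler_sum _ (fun N H => gcd_sigma_indicator D1 nL T1 H)) _.
rewrite -big_nat !big_split /= -mulr_suml.
have -> : n%:R * (17 / D%:R + 24 * ln D%:R / ln T) =
  n%:R * (16 / D%:R) + n%:R * D%:R^-1 + n%:R * (4 * ln (D ^ 6)%:R) / ln T :> R.
  by rewrite natrX lnXn; [field; rewrite !gt_eqF //; lra | lra].
apply: lerD; first apply: lerD; last 1 first.
- by apply: ler_wpM2r; [rewrite invr_ge0 ltW | exact: sum_smooth_weight].
- rewrite exchange_big /=.
  apply: (@le_trans _ _ (\sum_((D ^ 6).+1 <= p < n.+1) n%:R * (8 * D%:R / (p%:R * Num.sqrt p%:R)))).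
    rewrite big_mkcond /= big_nat [leRHS]big_nat; apply: ler_sum => p /andP[Dp _].
    have pR : 0 < (p%:R : R) by rewrite ltr0n; lia.
    have s0 : 0 < Num.sqrt (p%:R : R) by rewrite sqrtr_gt0.
    case: ifP => [pp|_]; last by rewrite !mulr_ge0 ?invr_ge0 ?mulr_ge0 ?sqrtr_ge0.
    rewrite exchange_big /=.
    apply: (@le_trans _ _ (\sum_(2 <= k < (2 ^ L).+1 | prime (p * k - 1))
       n%:R * (p%:R^-1 * (p * k - 1)%:R^-1))).
      apply: ler_sum => k pk; rewrite -invfM -natrM.
      by apply: sum_dvdn_le; rewrite muln_gt0 !prime_gt0.
    rewrite -mulr_sumr ler_wpM2l // -mulr_sumr.
    rewrite invfM mulrCA ler_wpM2l ?invr_ge0 //.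
    apply: le_trans (sum_inv_primes_progression R L pp) _.
    rewrite mulrAC; apply: ler_wpM2r; first by rewrite invr_ge0 ltW.
    by apply: ler_wpM2l => //; exact: harmonic_bound.
  rewrite -mulr_sumr ler_wpM2l // -mulr_sumr.
  have ED : D%:R * (D%:R * D%:R) = Num.sqrt ((D ^ 6)%:R) :> R.
    rewrite natrX (exprM _ 3 2) sqrtr_sqr ger0_norm ?exprn_ge0 //.
  apply: le_trans (ler_wpM2l _ (sum_inv_sqrt3_tail R n.+1 D6)) _; first by lra.
  rewrite -ED.
  have -> : 8 * D%:R * (2 / (D%:R * (D%:R * D%:R))) = 16 / D%:R / D%:R :> R.
    by field; lra.
  rewrite ler_pdivrMr; last lra.
  by rewrite ler_peMr ?divr_ge0 //; lra.
- rewrite exchange_big /=.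
  apply: (@le_trans _ _ (\sum_(D.+1 <= d < n.+1) n%:R * (d ^ 2)%:R^-1)).
    rewrite big_nat [leRHS]big_nat; apply: ler_sum => d /andP[Dd _].
    by apply: sum_dvdn_le; rewrite expn_gt0; lia.
  by rewrite -mulr_sumr ler_wpM2l // sum_inv_sqr_tail; lia.
Qed.

(** * Passage to natural density *)

Lemma count_upto_sum (R : realType) (S : set nat) (x : R) : 0 <= x ->
  (forall N, S N -> (0 < N)%N) ->
  (count_upto S x)%:R =
  \sum_(1 <= N < (Num.truncn x).+1) (`[< S N >] : nat)%:R :> R.
Proof.
move=> x0 S0; rewrite /count_upto.
have -> : [set n : nat | S n /\ n%:R <= x] =
  [set` [fset N in [seq N <- index_iota 1 (Num.truncn x).+1 | `[< S N >]]]%fset].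
  apply/seteqP; split => N /=; rewrite inE /= mem_filter mem_index_iota ltnS truncn_ge_nat //.
    by move=> [SN ->]; rewrite S0 // andbT; apply/andP; split => //; exact/asboolP.
  by move=> /andP[/asboolP SN /andP[_ Nx]].
rewrite set_fsetK card_fseq undup_id ?filter_uniq ?iota_uniq //.
by rewrite size_filter -sum1_count natr_sum big_mkcond /=; apply: eq_bigr => N _; case: ifP.
Qed.

Lemma sum_leq_indicator (R : realType) n m :
  \sum_(1 <= N < n.+1) ((N <= m)%N%:R : R) <= m%:R.
Proof.
rewrite -natr_sum ler_nat.
suff H : (\sum_(1 <= N < n.+1) (N <= m) <= minn n m)%N by apply: leq_trans H (geq_minr _ _).
elim: n => [|n IH]; first by rewrite big_geq.
by rewrite big_nat_recr //=; lia.
Qed.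

(** Since [n >= 2 ^ (L - 1)] and [8 * D <= 2 ^ D], [N >= 2 ^ (L - D)]. Since [L >= 2 ^ (D - 1)],
    this gives [ln N >= 2 ^ (D - 3)], and [(D - 3) / 2 >= sqrt D] once [D >= 16]. *)
Lemma sqrt_le_lnln (R : realType) N n D L : (15 < D)%N -> (2 ^ L <= n.*2)%N ->
  (2 ^ D <= L.*2)%N -> (n < N * D)%N ->
  Num.sqrt (D%:R : R) <= ln (ln N%:R).
Proof.
move=> D16 Ln DL nN.
have D2 : (D * 8 <= 2 ^ D)%N.
  have -> : D = (D - 16 + 16)%N by lia.
  elim: (D - 16)%N => [//|j IH]; rewrite addSn expnS; lia.
have LN : (2 ^ (L - D) <= N)%N.
  have : (2 ^ L = 2 ^ (L - D) * 2 ^ D)%N by rewrite -expnD subnK //; lia.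
  move: (2 ^ (L - D))%N (2 ^ L)%N Ln => a b Ln Eb.
  by rewrite leqNgt; apply/negP => Na; nia.
have /andP[l2 _] := ln2_bounds R.
have lN : (2 ^ (D - 3))%:R <= ln (N%:R : R).
  have := le_ln_nat R (_ : (0 < 2 ^ (L - D))%N) LN; rewrite expn_gt0 => /(_ isT).
  apply: le_trans; rewrite [in leRHS]natrX lnXn // -[leRHS]mulr_natl.
  have H : (2 ^ (D - 3) * 2 <= L - D)%N.
    have : (2 ^ D = 2 ^ (D - 3) * 8)%N by rewrite -[8%N]/(2 ^ 3)%N -expnD subnK //; lia.
    lia.
  have : (2 ^ (D - 3) * 2)%:R <= (L - D)%:R :> R by rewrite ler_nat.
  have : 0 <= (L - D)%:R :> R by [].
  rewrite natrM; nra.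
apply: (@le_trans _ _ (ln (2 ^ (D - 3))%:R)); last first.
  have p0 : 0 < (2 ^ (D - 3))%:R :> R by rewrite ltr0n expn_gt0.
  by rewrite ler_ln ?posrE // (lt_le_trans p0).
rewrite natrX lnXn // -[leRHS]mulr_natl.
have s4 : 4 <= Num.sqrt (D%:R : R).
  have -> : 4 = Num.sqrt (16%:R : R) by rewrite (_ : 16%:R = 4 ^+ 2) ?sqrtr_sqr ?ger0_norm //; ring.
  by rewrite ler_sqrt // ler_nat.
have : Num.sqrt (D%:R : R) ^+ 2 = D%:R by rewrite sqr_sqrtr.
rewrite natrB; last by lia.
set s := Num.sqrt _ in s4 *; move=> sD.
have H : 2 * s <= D%:R - 3 by nra.
nra.
Qed.

Theorem theorem1p1 (R : realType) (f : nat -> R)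
    (f_infty : f N @[N --> \oo] --> +oo) :
  exists S : set nat,
    natural_density_zero R S /\
    forall N : nat, (16 <= N)%N -> ~ S N ->
      (gcdn N (sigma N))%:R <= ln (ln (N%:R : R)) `^ f N.
Proof.
(* [S] is exactly the exceptional set, so only its density needs work. *)
pose S := [set N : nat | (16 <= N)%N /\
  ln (ln (N%:R : R)) `^ f N < (gcdn N (sigma N))%:R].
exists S; split; last first.
  by move=> N N16 SN; rewrite leNgt; apply/negP => H; apply: SN.
apply/cvgrPdist_le => e e0.
(* Chosen so that [24 * ln D / ln T = 48 / K = e / 4] for [T = D ^ (K / 2)]. *)
pose K := 192 / e.
have K0 : 0 < K by rewrite divr_gt0.
have [N0 _ fK] := (cvgryPge f).1 f_infty K.
(* [72 / e] makes [18 / D <= e / 4]; the 16 meets the size condition of [sqrt_le_lnln]. *)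
pose D0 := (Num.truncn (72 / e) + 16)%N.
have eD0 : 72 / e <= D0%:R.
  by rewrite natrD; apply/ltW; have := truncnS_gt (72 / e); rewrite -natr1; lra.
near=> x.
have x0 : 0 < x by near: x; exact: nbhs_pinfty_gt.
rewrite sub0r normrN ger0_norm; last by apply: divr_ge0 => //; exact: ltW.
rewrite ler_pdivrMr // (count_upto_sum (ltW x0)); last by move=> N [N16 _]; lia.
set n := Num.truncn x.
have nx : n%:R <= x by rewrite truncn_le ltW.
have nD0 : (2 ^ 2 ^ D0 <= n)%N.
  by rewrite truncn_ge_nat ?ltW //; near: x; exact: nbhs_pinfty_ge.
have N0n : N0%:R * (4 / e) <= n%:R.
  apply: (@le_trans _ _ (Num.truncn (N0%:R * (4 / e))).+1%:R); first exact/ltW/truncnS_gt.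
  by rewrite ler_nat truncn_ge_nat ?ltW //; near: x; exact: nbhs_pinfty_ge.
have n0 : (0 < n)%N by apply: leq_trans nD0; rewrite expn_gt0.
(* [L] and [D] are the binary lengths of [n] and of [L], the integer forms of log n and log log
   n. *)
pose L := (trunc_log 2 n).+1.
pose D := (trunc_log 2 L).+1.
have nL : (n < 2 ^ L)%N by exact: trunc_log_ltn.
have LD : (L < 2 ^ D)%N by exact: trunc_log_ltn.
have Ln : (2 ^ L <= n.*2)%N by rewrite expnS mul2n leq_double trunc_logP.
have DL : (2 ^ D <= L.*2)%N by rewrite expnS mul2n leq_double trunc_logP.
have DD : (D0 <= D)%N.
  by apply/leqW/trunc_log_max => //; apply/leqW/trunc_log_max.
have D16 : (15 < D)%N by rewrite /D0 in DD; lia.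
have DR : 15 < (D%:R : R) by rewrite ltr_nat.
have lD : 0 < ln (D%:R : R) by rewrite ln_gt0 //; lra.
pose T := expR (K / 2 * ln D%:R).
have T1 : 1 < T by rewrite expR_gt1; apply: mulr_gt0 lD; exact: divr_gt0.
have nR : 0 < (n%:R : R) by rewrite ltr0n.
(* An exceptional [N] is at most [N0], where [f N >= K] may fail, or at most [n %/ D], where log log
   N may be too small, or has gcd above [T]. *)
apply: (@le_trans _ _ (\sum_(1 <= N < n.+1) ((N <= N0)%N%:R + (N <= n %/ D)%N%:R +
   ((T < (gcdn N (sigma N))%:R)%R)%:R))).
  rewrite big_nat [leRHS]big_nat; apply: ler_sum => N /andP[N1 Nn].
  case: asboolP => [[N16 gN]|_]; last by rewrite !addr_ge0.
  have [NN0|NN0] := leqP N N0; first by rewrite -addrA lerDl addr_ge0.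
  have [ND|ND] := leqP N (n %/ D); first by rewrite add0r lerDl.
  rewrite !add0r.
  suff -> : T < (gcdn N (sigma N))%:R by [].
  apply: le_lt_trans gN.
  have nND : (n < N * D)%N by rewrite -ltn_divLR //; lia.
  have sl := sqrt_le_lnln R D16 Ln DL nND.
  have s0 : 0 < Num.sqrt (D%:R : R) by rewrite sqrtr_gt0; lra.
  have ll0 : 0 < ln (ln (N%:R : R)) by exact: lt_le_trans sl.
  (* The positive base rules out the default value of the power at 0. The exponent [K / 2] in [T]
     reflects [ln (sqrt D) = ln D / 2]. *)
  rewrite /powR gt_eqF // ler_expR.
  have fN : K <= f N by apply: fK => /=; exact: ltnW.
  have ED : ln (D%:R : R) = 2 * ln (Num.sqrt (D%:R : R)).
    by rewrite -{1}[D%:R]sqr_sqrtr ?lnXn ?mulr_natl.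
  have lsl : ln (Num.sqrt (D%:R : R)) <= ln (ln (ln N%:R)) by rewrite ler_ln.
  rewrite ED in lD *.
  nra.
rewrite !big_split /=.
have H1 := sum_leq_indicator R n N0.
have H2 := sum_leq_indicator R n (n %/ D).
have H3 := @count_large_gcd_sigma R n D L T (leq_trans (isT : 1 < 16)%N D16) LD (ltnW nL) T1.
apply: (@le_trans _ _ (e * n%:R)); last by rewrite ler_pM2l.
have iD : D%:R^-1 <= e / 72.
  have : 72 / e <= D%:R by apply: le_trans eD0 _; rewrite ler_nat.
  rewrite ler_pdivrMr // => H; rewrite -[leLHS]div1r ler_pdivrMr; lra.
have H2' : (n %/ D)%:R <= n%:R * D%:R^-1 :> R.
  by rewrite ler_pdivlMr ?(lt_trans _ DR) // -natrM ler_nat leq_trunc_div.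
have E : 24 * ln D%:R / ln T = e / 4.
  by rewrite expRK /K; field; rewrite !gt_eqF //; lra.
rewrite E in H3.
have N0e : N0%:R <= n%:R * (e / 4).
  by rewrite -ler_pdivrMr ?divr_gt0 // invf_div.
have : n%:R * D%:R^-1 <= n%:R * (e / 72) by rewrite ler_pM2l.
rewrite mulrDr mulrCA in H3.
(* The pieces sum to at most [n * e] times 1/4 + 1/72 + 17/72 + 1/4 = 3/4. *)
have : 0 < n%:R * e by rewrite mulr_gt0.
lra.
Unshelve. all: by end_near.
Qed.
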